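(* Let $q$ be a power of the odd prime $p$ and let $f$ be a planar function on $\mathbb F_{q^2}$ which either can be written as a Dembowski–Ostrom polynomial over $\mathbb F_{q^2}$ or is the Coulter–Matthews function $f(x)=x^{(3^k+1)/2}$ (with $p=3$, $q=3^n$, $\gcd(k,2n)=1$). Let $\theta\in\mathbb F_{q^2}^*$ be such that $\mathcal U_\theta:=\{(x,t\theta):x\in\mathbb F_{q^2},t\in\mathbb F_q\}\cup\{(\infty)\}$ is a unital in $\Pi(f)$. Then, as designs, $\mathcal U_\theta$ and the classical unital $\mathcal H$ of order $q$ are not isomorphic.
   Context: A Dembowski–Ostrom polynomial over $\mathbb F_{q^2}$ is one of the form $\sum_{i,j}a_{ij}x^{p^i+p^j}$ with $a_{ij}\in\mathbb F_{q^2}$; planar means $x\mapsto f(x+a)-f(x)$ is bijective for each $a\neq0$. $\Pi(f)$ is the projective plane with points $(x,y)\in\mathbb F_{q^2}^2$ and $(a)$ for $a\in\mathbb F_{q^2}\cup\{\infty\}$, lines $L_{a,b}=\{(x,f(x+a)-b):x\in\mathbb F_{q^2}\}\cup\{(a)\}$, $N_a=\{(a,y):y\in\mathbb F_{q^2}\}\cup\{(\infty)\}$ ($a,b\in\mathbb F_{q^2}$), $L_\infty=\{(a):a\in\mathbb F_{q^2}\cup\{\infty\}\}$. A unital in a projective plane of order $q^2$ is a set of $q^3+1$ points meeting every line in $1$ or $q+1$ points; it is regarded as a $2$-$(q^3+1,q+1,1)$ design whose blocks are its intersections with lines meeting it in $q+1$ points. The classical unital $\mathcal H$ is the Hermitian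 curve $\{(X:Y:Z)\in\mathrm{PG}(2,q^2):X^{q+1}+Y^{q+1}+Z^{q+1}=0\}$ with this design structure. Two designs are isomorphic if there is a bijection between their point sets mapping blocks onto blocks. *)

(* Defs.v *)
From HB Require Import structures.
From mathcomp Require Import all_boot all_order all_algebra all_field.
Set Implicit Arguments. Unset Strict Implicit. Unset Printing Implicit Defensive.
Import GRing.Theory.
Local Open Scope ring_scope.

Definition planar (F : finFieldType) (f : F -> F) : Prop :=
  forall a : F, a != 0 -> bijective (fun x => f (x + a) - f x).

Definition is_DO (p : nat) (F : finFieldType) (f : F -> F) : Prop :=
  exists (n : nat) (a : 'I_n -> 'I_n -> F),
    forall x : F, f x = \sum_(i < n) \sum_(j < n) a i j * x ^+ (p ^ i + p ^ j)%N.

Definition is_CM (p q : nat) (F : finFieldType) (f : F -> F) : Prop :=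
  p = 3%N /\ exists n k : nat, q = (3 ^ n)%N /\ coprime k (2 * n) /\
    forall x : F, f x = x ^+ ((3 ^ k + 1) %/ 2).

Definition blocks_of (T : finType) (Ls : {set {set T}}) (U : {set T}) (k : nat)
  : {set {set T}} :=
  [set U :&: L | L in Ls & #|U :&: L| == k].

Definition is_unital (T : finType) (q : nat) (Ls : {set {set T}}) (U : {set T}) : Prop :=
  #|U| = (q ^ 3 + 1)%N /\
  forall L, L \in Ls -> (#|U :&: L| == 1%N) || (#|U :&: L| == q.+1).

Definition design_iso (T1 T2 : finType) (P1 : {set T1}) (B1 : {set {set T1}})
    (P2 : {set T2}) (B2 : {set {set T2}}) : Prop :=
  exists phi : T1 -> T2,
    {in P1 &, injective phi} /\ phi @: P1 = P2 /\
    [set (phi @: b : {set T2}) | b : {set T1} in B1] = B2.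

(* inl (x,y) = affine point (x,y); inr (Some a) = (a); inr None = (infinity). *)
Definition PiPoint (F : finFieldType) : finType := ((F * F) + option F)%type.

Definition Lab (F : finFieldType) (f : F -> F) (a b : F) : {set PiPoint F} :=
  [set (inl (x, f (x + a) - b) : PiPoint F) | x : F] :|: [set (inr (Some a) : PiPoint F)].

Definition Na (F : finFieldType) (a : F) : {set PiPoint F} :=
  [set (inl (a, y) : PiPoint F) | y : F] :|: [set (inr None : PiPoint F)].

Definition Linf (F : finFieldType) : {set PiPoint F} :=
  [set (inr a : PiPoint F) | a : option F].

Definition piLines (F : finFieldType) (f : F -> F) : {set {set PiPoint F}} :=
  [set Lab f ab.1 ab.2 | ab : F * F] :|: [set Na a | a : F] :|: [set Linf F].

Definition subFq (F : finFieldType) (q : nat) : {set F} := [set t : F | t ^+ q == t].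

Definition Utheta (F : finFieldType) (q : nat) (theta : F) : {set PiPoint F} :=
  [set (inl (x, t * theta) : PiPoint F) | x in [set: F], t in subFq F q]
  :|: [set (inr None : PiPoint F)].

(* Points of PG(2,F) are represented by normalized homogeneous coordinates
   (X,Y,Z): (x,y,1), (x,1,0), (1,0,0). A triple ((X,Y),Z). *)
Definition PGcoord (F : finFieldType) : finType := ((F * F) * F)%type.

Definition pg_normalized (F : finFieldType) (P : PGcoord F) : bool :=
  (P.2 == 1) || ((P.2 == 0) && (P.1.2 == 1)) ||
  [&& P.2 == 0, P.1.2 == 0 & P.1.1 == 1].

Definition pgPoints (F : finFieldType) : {set PGcoord F} := [set P | pg_normalized P].

Definition pgLine (F : finFieldType) (abc : PGcoord F) : {set PGcoord F} :=
  [set P in pgPoints F | abc.1.1 * P.1.1 + abc.1.2 * P.1.2 + abc.2 * P.2 == 0].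

Definition pgLines (F : finFieldType) : {set {set PGcoord F}} :=
  [set pgLine abc | abc in [set abc : PGcoord F | abc != (0, 0, 0)]].

Definition hermitian_curve (F : finFieldType) (q : nat) : {set PGcoord F} :=
  [set P in pgPoints F | P.1.1 ^+ q.+1 + P.1.2 ^+ q.+1 + P.2 ^+ q.+1 == 0].

(* Main.v *)
(* Since f is even, every map (x, y) |-> (2a - x, y) is an automorphism of the
   unital U_theta: an involution that fixes the block N_a pointwise and fixes
   no other block through the point at infinity. A product
   of three of these maps is again one of them.
   Suppose U_theta were isomorphic to the Hermitian curve. Coordinates adapted
   to the image of the point at infinity turn the remaining points of the curve
   into the pairs (x, y) with y + y^q = x^(q+1); its blocks become non-vertical
   lines, and the blocks through infinity become vertical ones. The projections
   x of three points on a block are never F_q-collinear, and conversely three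
   non-F_q-collinear elements lift to a block, so each transported involution
   induces a collineation of the affine plane F_{q^2} over F_q with exactly one
   fixed point alpha. By parity and parallelism this is x |-> 2 alpha - x, and
   then the involution itself must be
   (x, y) |-> (2 alpha - x, y + 2 alpha^q (alpha - x)).
   These reflections generate a Heisenberg-type group: the product of three of
   them is a reflection only if their centers are F_q-collinear, a
   contradiction. *)
Require Import Defs.
From HB Require Import structures.
From mathcomp Require Import all_boot all_order all_algebra all_field ring.
Set Implicit Arguments. Unset Strict Implicit. Unset Printing Implicit Defensive.
Import GRing.Theory.
Local Open Scope ring_scope.

(** * Fixed points by parity, and certificates for equations *)

(** Removing a moved point together with its image keeps the set stable and its cardinality odd, so
    induction on the cardinality ends at a fixed point. *)
Lemma involution_fixpoint (T : finType) (A : {set T}) (s : T -> T) :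
  {in A, forall x, s x \in A} -> {in A, forall x, s (s x) = x} -> odd #|A| ->
  exists2 x, x \in A & s x = x.
Proof.
have [n] := ubnP #|A|; elim: n A => // n IHn A leAn sA ssA oddA.
have [x Ax] : exists x, x \in A by apply/card_gt0P; case: #|A| oddA.
have [sxx | sxNx] := eqVneq (s x) x; first by exists x.
have cardA : #|A| = #|A :\ x :\ s x|.+2.
  by rewrite (cardsD1 x A) Ax (cardsD1 (s x)) !inE sxNx sA.
have stable : {in A :\ x :\ s x, forall y, s y \in A :\ x :\ s x}.
  move=> y; rewrite !inE => /and3P[yNsx yNx Ay]; rewrite sA // andbT.
  by apply/andP; split; [apply: contraNneq yNx | apply: contraNneq yNsx] => e;
    rewrite -(ssA y) // e ?ssA.
case: (IHn (A :\ x :\ s x)) => [||y||y].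
- by rewrite cardA ltnS in leAn; apply: ltnW.
- exact: stable.
- by rewrite !inE => /and3P[_ _ Ay]; apply: ssA.
- by rewrite cardA /= negbK in oddA.
by rewrite !inE => /and3P[_ _ Ay] sy; exists y.
Qed.

(** This lemma and the next reduce a goal to a [ring] identity: its difference is exhibited as an
    explicit combination of known vanishing differences. Taking [k2 := 0] uses a single
    hypothesis. *)
Lemma eq_of_diff (V : zmodType) (a b x : V) : x = 0 -> a - b = x -> a = b.
Proof. by move=> -> /eqP; rewrite subr_eq0 => /eqP. Qed.

Lemma eq_of_lincomb2 (R : pzRingType) (k1 k2 a1 b1 a2 b2 a b : R) :
  a1 = b1 -> a2 = b2 -> a - b = k1 * (a1 - b1) + k2 * (a2 - b2) -> a = b.
Proof. by move=> -> ->; rewrite !subrr !mulr0 addr0 => /eqP; rewrite subr_eq0 => /eqP. Qed.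

(** * The affine Hermitian curve and its secants *)

Section AffineHermitian.

Variables (F : finFieldType) (c : {rmorphism F -> F}).
Hypothesis cK : involutive c.
Hypothesis two_neq0 : (2 : F) != 0.

Definition aherm (A : F * F) : bool := A.2 + c A.2 == A.1 * c A.1.

Definition det3 (A B C : F * F) : F :=
  (B.1 - A.1) * (C.2 - A.2) - (C.1 - A.1) * (B.2 - A.2).

(* [area x y z = 0] says that x, y, z are collinear over the fixed field of c. *)
Definition area (x y z : F) : F := (y - x) * c (z - x) - c (y - x) * (z - x).

Lemma conj_eq0 x : (c x == 0) = (x == 0).
Proof. exact: fmorph_eq0. Qed.

(** On a line of slope [m] through [A], an increment [d] of the abscissa stays on the curve iff
    [n * d + c n * c d = d * c d], where [n = m - c A.1]. This is a circle for the norm form, and a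
    line over the fixed field meets it in at most two points. *)
Lemma area_secant A B C : aherm A -> aherm B -> aherm C ->
  A.1 != B.1 -> A.1 != C.1 -> B.1 != C.1 -> det3 A B C = 0 ->
  area A.1 B.1 C.1 != 0.
Proof.
case: A B C => [x u] [y v] [z w]; rewrite /aherm /det3 /area /=.
move=> /eqP SA /eqP SB /eqP SC xy xz yz /eqP; rewrite subr_eq0 => /eqP H3.
have H3' := congr1 c H3.
apply: contraNneq yz => /eqP; rewrite subr_eq0 => /eqP H4.
(* Eliminating the ordinates leaves a product of conjugates of differences of distinct abscissas. *)
have : (z - x) * c (y - x) * (y - x) * c (z - y) = 0.
  pose d := y - x; pose e := z - x; pose p := v - u; pose r := w - u.
  have H1 : p + c p = d * c d + x * c d + c x * d.
    apply: (@eq_of_diff _ _ _ ((v + c v - y * c y) - (u + c u - x * c x))).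
      by rewrite SA SB !subrr.
    by rewrite /p /d; ring.
  have H2 : r + c r = e * c e + x * c e + c x * e.
    apply: (@eq_of_diff _ _ _ ((w + c w - z * c z) - (u + c u - x * c x))).
      by rewrite SA SC !subrr.
    by rewrite /r /e; ring.
  have -> : z - y = e - d by rewrite /e /d; ring.
  rewrite -/d -/e -/p -/r in H3 H3' H4 *.
  rewrite !rmorphM in H3'.
  apply: (@eq_of_diff _ _ _ (c d * (d * r - e * p) + d * (c d * c r - c e * c p)
     + (c p - x * c d) * (d * c e - c d * e) - d * c d * (r + c r - (e * c e + x * c e + c x * e))
     + e * c d * (p + c p - (d * c d + x * c d + c x * d)))).
    by rewrite H1 H2 H3 H3' H4 !subrr !mulr0 !addr0 subr0.
  by ring.
move/eqP; rewrite !mulf_eq0 !conj_eq0 !subr_eq0 [z == x]eq_sym [y == x]eq_sym (negPf xy) (negPf xz) /=.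
by rewrite eq_sym.
Qed.

Lemma secant_lift x1 x2 x3 : area x1 x2 x3 != 0 ->
  exists y1 y2 y3, [/\ aherm (x1, y1), aherm (x2, y2), aherm (x3, y3) &
                       det3 (x1, y1) (x2, y2) (x3, y3) = 0].
Proof.
rewrite /area => D0; set D := _ - _ in D0.
pose d := x2 - x1; pose e := x3 - x1.
pose n x := x * c x - x1 * c x1.
(* Slope of the desired line, by Cramer's rule for the system [md], [me] in the unknowns [m] and
   [c m]. Since [c D = - D], the second unknown is indeed the conjugate of the first. *)
pose m := (n x2 * c e - n x3 * c d) / D.
have cn x : c (n x) = n x by rewrite /n rmorphB !rmorphM !cK; ring.
have cD : c D = - D by rewrite /D rmorphB !rmorphM !cK; ring.
have cm : c m = - (n x2 * e - n x3 * d) / D.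
  by rewrite /m fmorph_div cD rmorphB !rmorphM !cn !cK invrN mulrN mulNr.
have eqD : D = d * c e - c d * e by [].
have md : m * d + c m * c d = n x2.
  have -> : m * d + c m * c d = n x2 * (d * c e - c d * e) / D by rewrite cm /m; ring.
  by rewrite -eqD mulfK.
have me : m * e + c m * c e = n x3.
  have -> : m * e + c m * c e = n x3 * (d * c e - c d * e) / D by rewrite cm /m; ring.
  by rewrite -eqD mulfK.
pose y := x1 * c x1 / 2.
have cy : c y = y by rewrite /y fmorph_div rmorph_nat rmorphM cK; ring.
have yy : y + y = x1 * c x1 by rewrite /y; field.
exists y, (y + m * d), (y + m * e); rewrite /aherm /det3 /=; split.
- by rewrite cy yy.
- by rewrite rmorphD rmorphM cy addrACA yy md /n; apply/eqP; ring.
- by rewrite rmorphD rmorphM cy addrACA yy me /n; apply/eqP; ring.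
- by rewrite /d /e; ring.
Qed.

Variable g : F.
Hypothesis cg : c g != g.

(** A section of the first projection of the curve: half the norm is fixed by [c], so its trace is
    the norm. *)
Definition base_point (x : F) : F * F := (x, x * c x / 2).

Lemma aherm_base_point x : aherm (base_point x).
Proof.
rewrite /aherm /= fmorph_div rmorph_nat rmorphM cK; apply/eqP.
by field.
Qed.

(** Cayley transform of the trace-zero element [g - c g]. *)
Lemma norm_one_unit : exists u, [/\ u * c u = 1, u != 1 & 1 + u != 0].
Proof.
pose w := g - c g.
have cw : c w = - w by rewrite /w rmorphB cK; ring.
have w0 : w != 0 by rewrite subr_eq0 eq_sym.
have w1 : 1 - w != 0.
  apply: contraNneq two_neq0 => /eqP; rewrite subr_eq0 => /eqP w1.
  apply/eqP; apply: (@eq_of_diff _ _ _ (c w - - w)); first by rewrite cw subrr.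
  by rewrite -w1 (rmorph1 c); ring.
have cw1 : c (1 - w) = 1 + w by rewrite rmorphB (rmorph1 c) cw opprK.
have w2 : 1 + w != 0 by rewrite -cw1 conj_eq0.
have cw2 : c (1 + w) = 1 - w by rewrite rmorphD (rmorph1 c) cw.
exists ((1 + w) / (1 - w)); split.
- by rewrite fmorph_div cw1 cw2; field; apply/andP.
- apply: contraNneq w0 => e; apply: contraT => w0.
  have : 2 * w = 0.
    apply: (@eq_of_diff _ _ _ ((1 - w) * ((1 + w) / (1 - w) - 1))); first by rewrite e subrr mulr0.
    by field.
  by move/eqP; rewrite mulf_eq0 (negPf two_neq0) (negPf w0).
- have -> : 1 + (1 + w) / (1 - w) = 2 / (1 - w) by field.
  by rewrite mulf_neq0 ?invr_eq0.
Qed.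

Lemma secant_third_point A B : aherm A -> aherm B -> A.1 != B.1 ->
  exists C, [/\ aherm C, C.1 != A.1, C.1 != B.1 & det3 A B C = 0].
Proof.
case: A B => [x1 y1] [x2 y2]; rewrite /aherm /det3 /= => /eqP SA /eqP SB x12.
pose d := x2 - x1; have d0 : d != 0 by rewrite subr_eq0 eq_sym.
pose m := (y2 - y1) / d; pose n := m - c x1.
have md : m * d = y2 - y1 by rewrite /m divfK.
have nd : n * d + c n * c d = d * c d.
  have -> : n * d + c n * c d = m * d + c (m * d) - c x1 * d - x1 * c d.
    by rewrite /n rmorphB rmorphM cK; ring.
  rewrite md.
  apply: (@eq_of_diff _ _ _ ((y2 + c y2 - x2 * c x2) - (y1 + c y1 - x1 * c x1))).
    by rewrite SA SB !subrr.
  by rewrite /d; ring.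
have n0 : n != 0.
  apply/eqP => n0; move: nd; rewrite n0 (rmorph0 c) !mul0r addr0 => /esym /eqP.
  by rewrite mulf_eq0 conj_eq0 orbb (negPf d0).
(* The points of the secant have abscissas [x1 + c n * (1 + u)] with [u] of norm one. The value [-1]
   gives [A]; [1] is the default choice, and is replaced by another norm-one element when it gives
   [B]. *)
have [u [uu u1 ud]] : exists u, [/\ u * c u = 1, 1 + u != 0 & c n * (1 + u) != d].
  have [u [uu u1 u2]] := norm_one_unit.
  have [e|] := eqVneq (c n * 2) d; last first.
    by exists 1; split => //; rewrite (rmorph1 c) mulr1.
  exists u; split => //; rewrite -e; apply: contraNneq u1 => /(mulfI _) E.
  have := E; rewrite conj_eq0 n0 => /(_ isT) => E1.
  by apply/eqP/(addrI 1); rewrite E1.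
pose e := c n * (1 + u).
exists (x1 + e, y1 + m * e); rewrite /=; split.
- have ne : n * e + c n * c e = e * c e.
    rewrite /e [c (c n * _)]rmorphM cK [c (1 + u)]rmorphD (rmorph1 c).
    by apply: (@eq_of_diff _ _ _ (n * c n * (1 - u * c u))); [rewrite uu subrr mulr0 | ring].
  apply/eqP.
  apply: (@eq_of_diff _ _ _ ((y1 + c y1 - x1 * c x1) + (n * e + c n * c e - e * c e))).
    by rewrite SA ne !subrr addr0.
  by rewrite /n rmorphB cK; ring.
- by rewrite -subr_eq0 addrAC subrr add0r mulf_neq0 ?conj_eq0.
- by apply: contraNneq ud => E; rewrite -/e /d -E addrAC subrr add0r.
- by rewrite [y1 + _ - _]addrAC subrr add0r -/d addrAC subrr add0r -md; ring.
Qed.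

(** The vertical shift [k] satisfies [c (k A) = - k A]. Along a secant, collinearity before and
    after [s] gives a linear relation between the differences of shifts; with its conjugate it forms
    a system of determinant [area], which is nonzero. Points with equal abscissas are compared
    through a third point. *)
Lemma vertical_constant (s : F * F -> F * F) :
  (forall A, aherm A -> aherm (s A)) ->
  (forall A, aherm A -> (s A).1 = A.1) ->
  (forall A B C, aherm A -> aherm B -> aherm C ->
     A.1 != B.1 -> A.1 != C.1 -> B.1 != C.1 ->
     det3 A B C = 0 -> det3 (s A) (s B) (s C) = 0) ->
  forall A B, aherm A -> aherm B -> (s A).2 - A.2 = (s B).2 - B.2.
Proof.
move=> sS s1 sD.
pose k A := (s A).2 - A.2.
have ck A : aherm A -> c (k A) = - k A.
  move=> SA; rewrite /k; have := sS _ SA; move: SA; rewrite /aherm => SA.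
  rewrite (s1 _ SA) => /eqP sSA; move/eqP: SA => SA.
  apply: (@eq_of_diff _ _ _ (((s A).2 + c (s A).2) - (A.2 + c A.2))).
    by rewrite SA sSA subrr.
  by ring.
have main A B : aherm A -> aherm B -> A.1 != B.1 -> k A = k B.
  move=> SA SB AB; have [C [SC CA CB D0]] := secant_third_point SA SB AB.
  rewrite eq_sym in CA; rewrite eq_sym in CB.
  have a0 := area_secant SA SB SC AB CA CB D0.
  have := sD _ _ _ SA SB SC AB CA CB D0.
  rewrite /det3 !s1 // => sD0.
  have E1 : (B.1 - A.1) * (k C - k A) - (C.1 - A.1) * (k B - k A) = 0.
    by apply: (eq_of_lincomb2 (k1 := 1) (k2 := -1) sD0 D0); rewrite /det3 /k; ring.
  have := congr1 c E1.
  rewrite (rmorph0 c) rmorphB !rmorphM [c (k C - _)]rmorphB [c (k B - _)]rmorphB !ck // => E2.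
  apply/esym/eqP; rewrite -subr_eq0; apply/eqP; apply: (mulfI a0); rewrite mulr0.
  apply: (eq_of_lincomb2 (k1 := c (B.1 - A.1)) (k2 := B.1 - A.1) E1 E2).
  by rewrite /area; ring.
move=> A B SA SB; rewrite -/(k A) -/(k B).
have [e|] := eqVneq A.1 B.1; last exact: main.
have ne : A.1 != (base_point (A.1 + 1)).1.
  by rewrite /= -subr_eq0 opprD addrA subrr add0r oppr_eq0 oner_eq0.
rewrite (main _ _ SA (aherm_base_point _) ne).
by rewrite (main B (base_point (A.1 + 1))) -?e ?aherm_base_point.
Qed.

(** * Involutions of the affine plane over the fixed field of [c] *)

Section PlaneInvolution.

Variable t : F -> F.
Hypothesis odd_fix : odd #|[set x | c x == x]|.
Hypothesis tK : involutive t.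
Hypothesis t_area : forall x y z, area x y z != 0 -> area (t x) (t y) (t z) != 0.

Lemma area0 x y z : area x y z = 0 -> area (t x) (t y) (t z) = 0.
Proof.
move=> a0; apply/eqP; apply: contraT => /t_area.
by rewrite !tK a0 eqxx.
Qed.

Lemma area_line x y z : x != y ->
  area x y z = 0 -> exists2 l, c l = l & z = x + l * (y - x).
Proof.
move=> xy a0; have yx0 : y - x != 0 by rewrite subr_eq0 eq_sym.
exists ((z - x) / (y - x)); last by rewrite divfK // addrC subrK.
rewrite fmorph_div; apply/eqP; rewrite eqr_div ?conj_eq0 //.
by apply/eqP; apply: (eq_of_lincomb2 (k1 := 1) (k2 := 0) a0 a0); rewrite /area; ring.
Qed.

Hypothesis t0 : t 0 = 0.
Hypothesis t_only : forall x, t x = x -> x = 0.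

(* [t] swaps [x] and [t x], so it stabilises the line through them; this line
   has an odd number of points, hence contains the fixed point 0. *)
Lemma involution_radial x : x != 0 -> exists2 l, c l = l & t x = l * x.
Proof.
move=> x0.
have xtx : x != t x by apply: contraNneq x0 => /esym /t_only ->.
pose A := [set z | area x (t x) z == 0].
have cardA : #|A| = #|[set x | c x == x]|.
  have -> : A = [set x + l * (t x - x) | l in [set x | c x == x]].
    apply/setP => z; rewrite inE; apply/eqP/imsetP.
      by case/area_line => // l cl ->; exists l; rewrite ?inE ?cl.
    case=> l; rewrite inE => /eqP cl ->.
    by rewrite /area !rmorphB !rmorphD rmorphM !rmorphB cl; ring.
  rewrite card_imset // => l l' /addrI /mulIf -> //.
  by rewrite subr_eq0 eq_sym.
have [|||z] := @involution_fixpoint F A t.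
- move=> z; rewrite !inE => /eqP /area0; rewrite tK => a0.
  by apply/eqP; apply: (eq_of_lincomb2 (k1 := -1) (k2 := 0) a0 a0); rewrite /area; ring.
- by [].
- by rewrite cardA.
rewrite inE => /eqP a0 /t_only z0; move: a0; rewrite {}z0 => a0.
have [||l cl ->] := @area_line 0 x (t x).
- by rewrite eq_sym.
- by apply: (eq_of_lincomb2 (k1 := 1) (k2 := 0) a0 a0); rewrite /area; ring.
by exists l => //; rewrite add0r subr0.
Qed.

(* Otherwise the line [x y] would meet its image in a point [z], whose radial
   image lies again on [x y]: then [z] is fixed although [x y] misses 0. *)
Lemma involution_ratio x y l m : area 0 x y != 0 -> c l = l -> c m = m ->
  t x = l * x -> t y = m * y -> l = m.
Proof.
move=> a0 cl cm tx ty; apply/eqP; apply: contraT => lm.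
have ml0 : m - l != 0 by rewrite subr_eq0 eq_sym.
(* This [b] makes the coefficients [l * (1 - b)] and [b * m] of [x] and [y] in [z] sum to 1, so that
   [z] lies on both lines. *)
have [b cb eb] : exists2 b, c b = b & b * (m - l) = 1 - l.
  exists ((1 - l) / (m - l)); last by rewrite divfK.
  by rewrite fmorph_div !rmorphB (rmorph1 c) cl cm.
pose z := l * x + b * (m * y - l * x).
have z1 : area x y z = 0.
  have -> : z = x + b * m * (y - x).
    by apply: (eq_of_lincomb2 (k1 := x) (k2 := 0) eb eb); rewrite /z; ring.
  by rewrite /area !rmorphB !rmorphD !rmorphM !rmorphB cb cm; ring.
have z2 : area (t x) (t y) z = 0.
  rewrite tx ty /area /z !rmorphB !rmorphD !rmorphM !rmorphB !rmorphM cb cm cl; ring.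
have z0 : z != 0.
  apply: contraNneq a0 => z0; rewrite z0 in z1; apply/eqP.
  by apply: (eq_of_lincomb2 (k1 := 1) (k2 := 0) z1 z1); rewrite /area; ring.
have [n cn tz] := involution_radial z0.
have := area0 z2; rewrite !tK tz => z3.
have : (1 - n) * area 0 x y = 0.
  apply: (eq_of_lincomb2 (k1 := 1) (k2 := - n) z3 z1).
  by rewrite /area !rmorphB !rmorphM cn (rmorph0 c); ring.
move/eqP; rewrite mulf_eq0 (negPf a0) orbF subr_eq0 => /eqP n1.
by rewrite -n1 mul1r in tz; rewrite (t_only tz) eqxx in z0.
Qed.

(** Both [x] and its image [l * x] are independent of [x * g] over the fixed field, so all three
    have the same ratio [l]. Hence [l ^+ 2 = 1], and [l = 1] would make [x] a nonzero fixed
    point. *)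
Lemma involution_opp x : t x = - x.
Proof.
have [->|x0] := eqVneq x 0; first by rewrite t0 oppr0.
have a0 z : c z = z -> z != 0 -> area 0 (z * x) (x * g) != 0.
  move=> cz z0; have -> : area 0 (z * x) (x * g) = z * (x * c x) * (c g - g).
    by rewrite /area !subr0 !rmorphM cz; ring.
  by rewrite !mulf_neq0 ?conj_eq0 // subr_eq0.
have xg0 : x * g != 0.
  by rewrite mulf_neq0 //; apply: contraNneq cg => ->; rewrite (rmorph0 c).
have [l cl tx] := involution_radial x0.
have [m cm ty] := involution_radial xg0.
have l0 : l != 0.
  by apply: contraNneq x0 => l0; rewrite -[x]tK tx l0 mul0r t0.
have [|n cn ttx] := @involution_radial (l * x); first by rewrite mulf_neq0.
have lm : l = m.
  by apply: (involution_ratio _ cl cm tx ty); have := a0 1; rewrite mul1r (rmorph1 c) oner_eq0; apply.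
have nm : n = m by apply: (involution_ratio _ cn cm ttx ty); apply: a0.
have : (l - 1) * (l + 1) = 0.
  apply: (mulIf x0); rewrite mul0r.
  apply: (@eq_of_diff _ _ _ (t (t x) - x)); first by rewrite tK subrr.
  by rewrite tx ttx nm -lm; ring.
move/eqP; rewrite mulf_eq0 subr_eq0 addr_eq0 tx => /orP[] /eqP l1.
  by rewrite l1 mul1r in tx; rewrite (t_only tx) eqxx in x0.
by rewrite l1 mulN1r.
Qed.

End PlaneInvolution.

(** * Reflections of the curve and the group they generate *)

Definition areflection (a : F) (A : F * F) : F * F :=
  (2 * a - A.1, A.2 + 2 * c a * (a - A.1)).

Lemma areflection_herm a A : aherm A -> aherm (areflection a A).
Proof.
rewrite /aherm /= => /eqP SA; apply/eqP.
apply: (eq_of_lincomb2 (k1 := 1) (k2 := 0) SA SA).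
by rewrite !rmorphD !rmorphM !rmorphB cK rmorph_nat; ring.
Qed.

(** Only incidence properties inherited from the reflection in a block through infinity are
    recorded, and only on the curve; no algebraic form of [s] is assumed. *)
Definition pointwise_reflection (a : F) (s : F * F -> F * F) : Prop :=
  [/\ forall A, aherm A -> aherm (s A),
      forall A, aherm A -> s (s A) = A,
      forall A B C, aherm A -> aherm B -> aherm C ->
        A.1 != B.1 -> A.1 != C.1 -> B.1 != C.1 ->
        det3 A B C = 0 -> det3 (s A) (s B) (s C) = 0
    & [/\ forall A B, aherm A -> aherm B -> A.1 = B.1 -> (s A).1 = (s B).1,
          forall A, aherm A -> A.1 = a -> s A = A
        & forall A, aherm A -> (s A).1 = A.1 -> A.1 = a]].

Lemma area_neq x y z : area x y z != 0 -> [/\ x != y, x != z & y != z].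
Proof.
move=> a0; split; apply: contraNneq a0 => ->; apply/eqP; rewrite /area.
- by rewrite subrr (rmorph0 c) !mul0r subrr.
- by rewrite subrr (rmorph0 c) !mulr0 subrr.
- by ring.
Qed.

Hypothesis odd_fix : odd #|[set x | c x == x]|.

(** By [secant_lift] and [area_secant] the map [t] induced on abscissas preserves non-collinearity,
    so [involution_opp], after moving [a] to 0, determines it. Composing [s] with [areflection a]
    then gives a map with constant vertical shift, which vanishes at [base_point a]. *)
Lemma pointwise_reflectionE a s : pointwise_reflection a s ->
  forall A, aherm A -> s A = areflection a A.
Proof.
case=> sS sK sD [s1 sfix sonly].
pose t x := (s (base_point x)).1.
have tE A : aherm A -> (s A).1 = t A.1.
  by move=> SA; apply: s1; rewrite ?aherm_base_point.
have tK : involutive t.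
  by move=> x; rewrite {2}/t -tE ?sS ?sK ?aherm_base_point.
have t_inj := can_inj tK.
have t_area x y z : area x y z != 0 -> area (t x) (t y) (t z) != 0.
  move=> a0; have [xy xz yz] := area_neq a0.
  have [x2 [y2 [z2 [SA SB SC D0]]]] := secant_lift a0.
  have X := tE _ SA; have Y := tE _ SB; have Z := tE _ SC; rewrite /= in X Y Z.
  rewrite -X -Y -Z; apply: area_secant; rewrite ?sS ?X ?Y ?Z ?(inj_eq t_inj) //.
  exact: sD.
have t_refl x : t x = 2 * a - x.
  have := @involution_opp (fun y => t (y + a) - a) odd_fix _ _ _ _ (x - a).
  rewrite subrK => H; rewrite -[t x](subrK a) H.
  - by ring.
  - by move=> y; rewrite subrK tK addrK.
  - move=> y z w a0; have e (u v b : F) : (u + b) - (v + b) = u - v by ring.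
    have /t_area : area (y + a) (z + a) (w + a) != 0.
      by rewrite /area !e.
    by rewrite /area !e.
  - by rewrite add0r /t sfix ?aherm_base_point //= subrr.
  - move=> y /eqP; rewrite subr_eq => /eqP e.
    by have := sonly (base_point (y + a)) (aherm_base_point _) e; rewrite /= -[RHS]add0r => /addIr.
pose s' A := areflection a (s A).
have s'1 A : aherm A -> (s' A).1 = A.1.
  by move=> SA; rewrite /s' /= tE // t_refl; ring.
have s'S A : aherm A -> aherm (s' A) by move=> SA; apply/areflection_herm/sS.
have s'D A B C : aherm A -> aherm B -> aherm C ->
     A.1 != B.1 -> A.1 != C.1 -> B.1 != C.1 ->
     det3 A B C = 0 -> det3 (s' A) (s' B) (s' C) = 0.
  move=> SA SB SC AB AC BC D0; have D1 := sD _ _ _ SA SB SC AB AC BC D0.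
  apply: (eq_of_lincomb2 (k1 := -1) (k2 := 0) D1 D1).
  by rewrite /s' /det3 /areflection /=; ring.
move=> A SA.
have E : (s' A).2 - A.2 = 0.
  rewrite (vertical_constant s'S s'1 s'D SA (aherm_base_point a)) /s'.
  by rewrite sfix ?aherm_base_point //=; ring.
rewrite [s A]surjective_pairing [RHS]surjective_pairing; congr (_, _).
  by rewrite tE ?t_refl.
apply: (eq_of_lincomb2 (k1 := 1) (k2 := 0) E E).
by rewrite /s' /= tE // t_refl; ring.
Qed.

(* A product of reflections with centers a, b, d is again a reflection only if
   a, b, d are collinear over the fixed field. *)
Lemma no_reflection_group (I : Type) (center : I -> F) (s : I -> F * F -> F * F) :
  (forall x, exists i, center i = x) ->
  (forall i, pointwise_reflection (center i) (s i)) ->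
  (forall i j k, exists l, forall A, aherm A -> s i (s j (s k A)) = s l A) ->
  False.
Proof.
move=> csurj srefl sprod.
have [i ci] := csurj 0; have [j cj] := csurj 1; have [k ck] := csurj g.
have [l] := sprod i j k.
(* At this point the first coordinates force the center [g - 1]; the second coordinates then force
   [c g = g]. *)
pose A := base_point 0; have SA : aherm A := aherm_base_point 0.
have sE h B : aherm B -> s h B = areflection (center h) B.
  exact: pointwise_reflectionE.
move=> /(_ A SA).
rewrite (sE k) // (sE l) // (sE j) ?areflection_herm // (sE i) ?areflection_herm //.
rewrite ci cj ck /areflection /A /= => -[e1 e2].
have cl : center l = g - 1.
  apply: (mulfI two_neq0).
  by apply: (eq_of_lincomb2 (k1 := -1) (k2 := 0) e1 e1); ring.
move: e2; rewrite cl rmorphB !(rmorph0 c) !(rmorph1 c) => e2.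
suff : c g = g by apply/eqP.
apply: (mulfI two_neq0).
by apply: (eq_of_lincomb2 (k1 := 1) (k2 := 0) e2 e2); ring.
Qed.

(** Multiplying the trace-zero element [y - x * c x / 2] by the trace-zero [w] lands in the fixed
    field. The bound serves to prove by counting that the coordinates reach the whole curve. *)
Lemma card_aherm_le : (#|[set A | aherm A]| <= #|F| * #|[set x | c x == x]|)%N.
Proof.
pose w := g - c g; have w0 : w != 0 by rewrite subr_eq0 eq_sym.
pose h (A : F * F) := (A.1, (A.2 - A.1 * c A.1 / 2) * w).
have h_inj : injective h.
  by move=> [x y] [x' y'] [<-] /(mulIf w0) /addIr <-.
rewrite -cardsT -cardsX -(card_imset _ h_inj); apply/subset_leq_card/subsetP.
move=> _ /imsetP[[x y] + ->]; rewrite !inE /aherm /= => /eqP Sxy.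
rewrite rmorphM rmorphB [c (_ / 2)]fmorph_div rmorph_nat [c (x * _)]rmorphM cK.
rewrite /w rmorphB cK; apply/eqP.
apply: (eq_of_lincomb2 (k1 := c g - g) (k2 := 0) Sxy Sxy).
by field.
Qed.

(** Interface between the two designs: [V] stands for the affine part of the unital, [G] for the
    coordinates of its image, [coll] for collinearity in the shift plane. The reflections [i a] are
    conjugated by [G]. *)
Lemma no_reflection_coordinates (V : {set F * F}) (G : F * F -> F * F)
    (coll : F * F -> F * F -> F * F -> Prop) :
  (forall a, (a, 0) \in V) ->
  (forall a x y, (x, y) \in V -> (2 * a - x, y) \in V) ->
  {in V &, injective G} ->
  G @: V = [set A | aherm A] ->
  {in V &, forall z w, ((G z).1 == (G w).1) = (z.1 == w.1)} ->
  {in V & &, forall z w v, z != w -> (coll z w v <-> det3 (G z) (G w) (G v) = 0)} ->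
  (forall a z w v, coll z w v ->
    coll (2 * a - z.1, z.2) (2 * a - w.1, w.2) (2 * a - v.1, v.2)) ->
  False.
Proof.
move=> V0 Vrefl Ginj Gim Gcol Gcoll coll_refl.
pose i a (z : F * F) := (2 * a - z.1, z.2).
have iV a z : z \in V -> i a z \in V by case: z => x y; apply: Vrefl.
(* Inverse of [G] on the curve; the default [(0, 0)] is reached only off it. *)
pose Gi A := odflt (0, 0) [pick z in V | G z == A].
have GiP A : aherm A -> Gi A \in V /\ G (Gi A) = A.
  move=> SA; rewrite /Gi; case: pickP => [z /andP[Vz /eqP] //|no].
  have /imsetP[z Vz e] : A \in G @: V by rewrite Gim inE.
  by have := no z; rewrite Vz e eqxx.
have GiV A : aherm A -> Gi A \in V by case/GiP.
have GGi A : aherm A -> G (Gi A) = A by case/GiP.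
have SG z : z \in V -> aherm (G z).
  by move=> Vz; have := imset_f G Vz; rewrite Gim inE.
have GiG z : z \in V -> Gi (G z) = z.
  by move=> Vz; apply: Ginj => //; rewrite ?GGi ?GiV ?SG.
pose s a A := G (i a (Gi A)).
pose center a := (G (a, 0)).1.
apply: (@no_reflection_group F center s).
- move=> x; have [VB GB] := GiP _ (aherm_base_point x).
  exists (Gi (base_point x)).1; transitivity (G (Gi (base_point x))).1; last by rewrite GB.
  by apply/eqP; rewrite Gcol.
- move=> a; split; [| | |split].
  + by move=> A SA; rewrite SG ?iV ?GiV.
  + move=> A SA; rewrite /s GiG ?iV ?GiV // -[RHS]GGi // /i /= [Gi A]surjective_pairing.
    by congr (G (_, _)) => /=; ring.
  + move=> A B C SA SB SC AB AC BC D0.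
    have [[VA VB] VC] := (GiV _ SA, GiV _ SB, GiV _ SC).
    have ne : (Gi A).1 != (Gi B).1 by rewrite -Gcol // !GGi.
    apply/Gcoll; rewrite ?iV //.
      by rewrite /i -pair_eqE /= (inj_eq (addrI _)) eqr_opp (negPf ne).
    apply: coll_refl; apply/Gcoll => //; last by rewrite !GGi.
    by apply: contraNneq ne => ->.
  + move=> A B SA SB e; apply/eqP; rewrite Gcol ?iV ?GiV //= (inj_eq (addrI _)) eqr_opp.
    by rewrite -Gcol ?GiV // !GGi ?e.
  + move=> A SA /eqP; rewrite /center -{1}(GGi A) // Gcol ?GiV //= => /eqP e.
    rewrite /s -[RHS]GGi // /i e [Gi A]surjective_pairing e.
    by congr (G (_, _)) => /=; ring.
  + move=> A SA; rewrite /s -{2}(GGi A) // => /eqP; rewrite Gcol ?iV ?GiV //= => /eqP e.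
    rewrite -(GGi A) //; apply/eqP; rewrite Gcol ?GiV //=; apply/eqP.
    apply: (mulfI two_neq0).
    by apply: (eq_of_lincomb2 (k1 := -1) (k2 := 0) e e); ring.
(* Because [2a - (2b - (2d - x)) = 2(a - b + d) - x]. *)
- move=> a b d; exists (a - b + d) => A SA.
  rewrite /s !GiG ?iV ?GiV // /i /=.
  by congr (G (_, _)); ring.
Qed.

(** * The Hermitian form and coordinates adapted to two of its isotropic points *)

Definition form (A B : PGcoord F) : F :=
  A.1.1 * c B.1.1 + A.1.2 * c B.1.2 + A.2 * c B.2.

Definition vdet (A B C : PGcoord F) : F :=
  A.1.1 * (B.1.2 * C.2 - B.2 * C.1.2) - A.1.2 * (B.1.1 * C.2 - B.2 * C.1.1)
  + A.2 * (B.1.1 * C.1.2 - B.1.2 * C.1.1).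

Lemma conj_form A B : c (form A B) = form B A.
Proof. by rewrite /form !rmorphD !rmorphM !cK; ring. Qed.

(** Determinant of the matrix of [A], [B], [C] times its conjugate transpose. *)
Lemma gram_det A B C :
  vdet A B C * c (vdet A B C) =
  vdet ((form A A, form A B), form A C) ((form B A, form B B), form B C)
       ((form C A, form C B), form C C).
Proof.
case: A B C => [[a1 a2] a3] [[b1 b2] b3] [[d1 d2] d3].
rewrite /vdet /form /=; ring.
Qed.

(** Testing on the unit vectors kills the cross product, so [A] and [B] are proportional, and
    normalization makes them equal. *)
Lemma pg_normalized_eq A B : pg_normalized A -> pg_normalized B ->
  (forall C, vdet A B C = 0) -> A = B.
Proof.
case: A B => [[a1 a2] a3] [[b1 b2] b3] nA nB V0.
have V1 := V0 ((1, 0), 0); have V2 := V0 ((0, 1), 0); have V3 := V0 ((0, 0), 1).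
have e1 : a1 * b2 = a2 * b1.
  by apply: (eq_of_lincomb2 (k1 := 1) (k2 := 0) V3 V3); rewrite /vdet /=; ring.
have e2 : a1 * b3 = a3 * b1.
  by apply: (eq_of_lincomb2 (k1 := -1) (k2 := 0) V2 V2); rewrite /vdet /=; ring.
have e3 : a2 * b3 = a3 * b2.
  by apply: (eq_of_lincomb2 (k1 := 1) (k2 := 0) V1 V1); rewrite /vdet /=; ring.
move: nA nB e1 e2 e3; rewrite /pg_normalized /= {V0 V1 V2 V3}.
move=> /orP[/orP[/eqP ->|/andP[/eqP -> /eqP ->]]|/and3P[/eqP -> /eqP -> /eqP ->]];
move=> /orP[/orP[/eqP ->|/andP[/eqP -> /eqP ->]]|/and3P[/eqP -> /eqP -> /eqP ->]];
rewrite ?mul0r ?mul1r ?mulr0 ?mulr1 => e1 e2 e3;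
by [rewrite ?e1 ?e2 ?e3 | move/eqP: e1; rewrite ?oner_eq0 1?eq_sym ?oner_eq0
   | move/eqP: e2; rewrite ?oner_eq0 1?eq_sym ?oner_eq0
   | move/eqP: e3; rewrite ?oner_eq0 1?eq_sym ?oner_eq0].
Qed.

(** Otherwise the Gram matrix of [A], [B] and any [C] has a zero 2 by 2 block, hence determinant
    zero. *)
Lemma isotropic_form_neq0 A B : pg_normalized A -> pg_normalized B -> A != B ->
  form A A = 0 -> form B B = 0 -> form A B != 0.
Proof.
move=> nA nB AB fA fB; apply: contraNneq AB => fAB; apply/eqP.
apply: pg_normalized_eq => // C; apply/eqP.
have fBA : form B A = 0 by rewrite -conj_form fAB (rmorph0 c).
have /eqP : vdet A B C * c (vdet A B C) = 0.
  by rewrite gram_det /vdet /= fA fB fAB fBA; ring.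
by rewrite mulf_eq0 conj_eq0 orbb.
Qed.

Section Coordinates.

Variables P Q : PGcoord F.
Hypothesis fP : form P P = 0.
Hypothesis fQ : form Q Q = 0.
Hypothesis fPQ : form P Q != 0.

Let fQP : form Q P != 0.
Proof. by rewrite -conj_form conj_eq0. Qed.

(** The tangent at [P] is the line at infinity, the line [PQ] becomes [x = 0] and the tangent at [Q]
    becomes [y = 0]; lines through [P] become vertical. *)
Definition coords (W : PGcoord F) : F * F :=
  (vdet P Q W / form W P, form Q P * form W Q / form W P).

(** With zero diagonal, the Gram determinant of [P], [Q], [W] is the sum of two conjugate cyclic
    products; dividing by [form W P * form P W] gives the equation of the curve. *)
Lemma aherm_coords W : form W P != 0 -> form W W = 0 -> aherm (coords W).
Proof.
move=> fWP fW; have fPW : form P W != 0 by rewrite -conj_form conj_eq0.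
rewrite /aherm /= !fmorph_div rmorphM !conj_form mulrACA gram_det /vdet /= fP fQ fW.
by apply/eqP; field; apply/andP.
Qed.

Lemma coords_col W1 W2 : form W1 P != 0 -> form W2 P != 0 ->
  ((coords W1).1 == (coords W2).1) = (vdet P W1 W2 == 0).
Proof.
move=> f1 f2; rewrite /= eqr_div // -subr_eq0.
have -> : vdet P Q W1 * form W2 P - vdet P Q W2 * form W1 P = - form Q P * vdet P W1 W2.
  apply: (eq_of_lincomb2 (k1 := vdet Q W1 W2) (k2 := 0) fP fP).
  by rewrite /vdet /form /=; ring.
by rewrite mulf_eq0 oppr_eq0 (negPf fQP).
Qed.

(** Homogeneous version of [coords], linear in [W] and without the scaling of the ordinate. *)
Definition functionals (W : PGcoord F) : PGcoord F :=
  (form W P, vdet P Q W, form W Q).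

Lemma vdet_functionals W1 W2 W3 :
  vdet (functionals W1) (functionals W2) (functionals W3) =
  form P Q * form Q P * vdet W1 W2 W3.
Proof.
apply: (eq_of_lincomb2 (k1 := - form Q Q * vdet W1 W2 W3) (k2 := 0) fP fP).
by rewrite /functionals /vdet /form /=; ring.
Qed.

Lemma coords_det W1 W2 W3 :
  form W1 P != 0 -> form W2 P != 0 -> form W3 P != 0 ->
  (det3 (coords W1) (coords W2) (coords W3) == 0) = (vdet W1 W2 W3 == 0).
Proof.
move=> f1 f2 f3.
have -> : det3 (coords W1) (coords W2) (coords W3) =
    form Q P * vdet (functionals W1) (functionals W2) (functionals W3) / (form W1 P * form W2 P * form W3 P).
  by rewrite [vdet (functionals _) _ _]/vdet /det3 /=; field; rewrite f1 f2 f3.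
rewrite vdet_functionals.
by rewrite !mulf_eq0 invr_eq0 !mulf_eq0 (negPf f1) (negPf f2) (negPf f3) (negPf fPQ) (negPf fQP) !orbF.
Qed.

Lemma coords_inj W1 W2 : pg_normalized W1 -> pg_normalized W2 ->
  form W1 P != 0 -> form W2 P != 0 -> coords W1 = coords W2 -> W1 = W2.
Proof.
move=> n1 n2 f1 f2 [/eqP ex /eqP ey]; apply: pg_normalized_eq => // C.
move: ex ey; rewrite !eqr_div // => /eqP ex /eqP ey.
have ey' : form W1 Q * form W2 P = form W2 Q * form W1 P.
  by apply: (mulfI fQP); rewrite !mulrA.
apply: (mulfI (mulf_neq0 f2 (mulf_neq0 fPQ fQP))).
rewrite mulr0 -mulrA -vdet_functionals.
apply: (eq_of_lincomb2 (k1 := form W2 Q * form C P - form W2 P * form C Q)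
                       (k2 := form W2 P * vdet P Q C - vdet P Q W2 * form C P) ex ey').
by rewrite [vdet (functionals _) _ _]/vdet /=; ring.
Qed.

End Coordinates.

End AffineHermitian.

Lemma power_rmorphism (F : fieldType) n : [pchar F].-nat n ->
  exists c : {rmorphism F -> F}, forall x, c x = x ^+ n.
Proof.
move=> charn; pose h (x : F) := x ^+ n.
have hB : zmod_morphism h by move=> x y; rewrite /h exprDn_pchar // exprNn_pchar.
have hM : monoid_morphism h.
  by split=> [|x y]; rewrite /h ?expr1n // exprMn.
pose cB := GRing.isZmodMorphism.Build F F h hB.
pose cM := GRing.isMonoidMorphism.Build F F h hM.
pose c : {rmorphism F -> F} := HB.pack h cB cM.
by exists c.
Qed.

(** * The shift plane and the affine part of the unital *)

Section ShiftPlane.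

Variables (F : finFieldType) (f : F -> F).

Lemma piLinesP (L : {set PiPoint F}) : L \in piLines f ->
  [\/ exists a b, L = Lab f a b, exists a, L = Na a | L = Linf F].
Proof.
rewrite !inE => /orP[/orP[]|/eqP ->]; last by constructor 3.
  by case/imsetP=> -[a b] _ ->; constructor 1; exists a, b.
by case/imsetP=> a _ ->; constructor 2; exists a.
Qed.

Lemma Lab_line a b : Lab f a b \in piLines f.
Proof. by rewrite !inE; apply/orP; left; apply/orP; left; apply/imsetP; exists (a, b). Qed.

Lemma Na_line (a : F) : Na a \in piLines f.
Proof. by rewrite !inE; apply/orP; left; apply/orP; right; apply/imsetP; exists a. Qed.

Lemma in_Lab a b z : (inl z \in Lab f a b) = (z.2 == f (z.1 + a) - b).
Proof.
rewrite !inE orbF; case: z => x y /=; apply/imsetP/eqP => [[x' _ [-> ->]] //|->].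
by exists x.
Qed.

Lemma in_Na a z : (inl z \in @Na F a) = (z.1 == a).
Proof.
rewrite !inE orbF; case: z => x y /=; apply/imsetP/eqP => [[y' _ [-> _]] //|->].
by exists y.
Qed.

Lemma in_Linf z : (inl z \in Linf F) = false.
Proof. by apply/imsetP => -[]. Qed.

Lemma infty_Lab a b : (inr None \in Lab f a b) = false.
Proof. by rewrite !inE orbF; apply/imsetP => -[]. Qed.

Lemma infty_Na a : inr None \in @Na F a.
Proof. by rewrite !inE eqxx orbT. Qed.

Definition collinear (A B C : PiPoint F) : Prop :=
  exists2 L, L \in piLines f & [/\ A \in L, B \in L & C \in L].

Lemma collinear_infty z w :
  collinear (inr None) (inl z) (inl w) <-> z.1 = w.1.
Proof.
split=> [[L /piLinesP[[a [b ->]]|[a ->]|->]] []|e].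
- by rewrite infty_Lab.
- by rewrite !in_Na => _ /eqP -> /eqP ->.
- by rewrite in_Linf.
by exists (Na z.1); rewrite ?Na_line // infty_Na !in_Na e.
Qed.

Hypothesis f_even : forall x, f (- x) = f x.

(** By evenness the reflection sends [Lab f d b] to [Lab f (- 2 * a - d) b], and it sends [Na d] to
    [Na (2 * a - d)]. *)
Lemma collinear_reflection a z w v : collinear (inl z) (inl w) (inl v) ->
  collinear (inl (2 * a - z.1, z.2)) (inl (2 * a - w.1, w.2)) (inl (2 * a - v.1, v.2)).
Proof.
case=> L /piLinesP[[d [b ->]]|[d ->]|->] [].
- have e x : f (2 * a - x + (- 2 * a - d)) = f (x + d).
    by rewrite -f_even; congr f; ring.
  rewrite !in_Lab => /eqP e1 /eqP e2 /eqP e3.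
  by exists (Lab f (- 2 * a - d) b); rewrite ?Lab_line // !in_Lab /= !e e1 e2 e3.
- rewrite !in_Na => /eqP -> /eqP -> /eqP ->.
  by exists (Na (2 * a - d)); rewrite ?Na_line // !in_Na.
- by rewrite in_Linf.
Qed.

Hypothesis f_planar : planar f.

Lemma join_affine z w : exists2 L, L \in piLines f & (inl z \in L) && (inl w \in L).
Proof.
have [e|ne] := eqVneq z.1 w.1.
  by exists (Na z.1); rewrite ?Na_line // !in_Na e !eqxx.
have d0 : w.1 - z.1 != 0 by rewrite subr_eq0 eq_sym.
have [h _ hK] := f_planar d0.
(* Planarity solves [f (u + (w.1 - z.1)) - f u = w.2 - z.2]; the line is then adjusted to pass
   through [z]. *)
pose u := h (w.2 - z.2); have := hK (w.2 - z.2); rewrite -/u => e.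
exists (Lab f (u - z.1) (f u - z.2)); first exact: Lab_line.
rewrite !in_Lab /=; apply/andP; split; apply/eqP.
  by rewrite [z.1 + _]addrC subrK; ring.
apply: (eq_of_lincomb2 (k1 := -1) (k2 := 0) e e).
have -> : w.1 + (u - z.1) = u + (w.1 - z.1) by ring.
by ring.
Qed.

Variables (q : nat) (theta : F).
Hypothesis theta0 : theta != 0.
Hypothesis unital : is_unital q (piLines f) (Utheta q theta).

Lemma in_Utheta z : (inl z \in Utheta q theta) = (z.2 / theta \in subFq F q).
Proof.
rewrite !inE orbF; case: z => x y /=; apply/imset2P/eqP => [[x' t _ + [_ ->]]|e].
  by rewrite mulfK // inE => /eqP.
by exists x (y / theta); rewrite ?inE ?e // divfK.
Qed.

Lemma infty_Utheta : inr None \in Utheta q theta.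
Proof. by rewrite !inE eqxx orbT. Qed.

Definition Uaff : {set F * F} := [set z | inl z \in Utheta q theta].

Lemma in_Uaff z : (z \in Uaff) = (inl z \in Utheta q theta).
Proof. by rewrite inE. Qed.

Lemma card_Uaff : #|Uaff| = (q ^ 3)%N.
Proof.
have [cardU _] := unital.
apply: (@addIn 1); rewrite -cardU (cardsD1 (inr None)) infty_Utheta addnC; congr (_ + _)%N.
have inl_inj : injective (@inl (F * F) (option F)) by move=> ? ? [].
rewrite -(card_imset _ inl_inj); apply: eq_card => p.
rewrite in_setD1; apply/imsetP/andP => [[z + ->]|[]]; first by rewrite in_Uaff.
case: p => [z _ Uz|]; first by exists z; rewrite ?in_Uaff.
move=> o o0; rewrite !inE => /orP[/imset2P[]//|/eqP e].
by rewrite e eqxx in o0.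
Qed.

(** Comparing this count with [card_Uaff] shows that the fixed field has [q] elements. *)
Lemma card_Uaff_fix : #|Uaff| = (#|F| * #|subFq F q|)%N.
Proof.
have h_inj : injective (fun z : F * F => (z.1, z.2 * theta)).
  by move=> [x y] [x' y'] /= [<- /(mulIf theta0) <-].
rewrite -cardsT -cardsX -(card_imset _ h_inj); apply: eq_card => -[x y].
rewrite in_Uaff in_Utheta; apply/idP/imsetP => [/= e|[[x' t]]].
  by exists (x, y / theta); rewrite ?in_setX ?inE ?divfK //; rewrite inE in e.
by rewrite in_setX => /andP[_ /= t1] [_ ->]; rewrite /= mulfK.
Qed.

Lemma join_Utheta A B : A \in Utheta q theta -> B \in Utheta q theta ->
  exists2 L, L \in piLines f & (A \in L) && (B \in L).
Proof.
have infU (o : option F) : inr o \in Utheta q theta -> o = None.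
  by rewrite !inE => /orP[/imset2P[]//|/eqP[]].
case: A B => [z|o] [w|o'] UA UB.
- exact: join_affine.
- by exists (Na z.1); rewrite ?Na_line // in_Na (infU _ UB) infty_Na eqxx.
- by exists (Na w.1); rewrite ?Na_line // in_Na (infU _ UA) infty_Na eqxx.
- by exists (Na 0); rewrite ?Na_line // (infU _ UA) (infU _ UB) infty_Na.
Qed.

Lemma secant_card L A B : L \in piLines f ->
  A \in Utheta q theta -> B \in Utheta q theta -> A != B -> A \in L -> B \in L ->
  #|Utheta q theta :&: L| == q.+1.
Proof.
move=> LL UA UB AB LA LB; have [_ /(_ L LL) /orP[|//]] := unital.
case/cards1P=> D e; have: A \in Utheta q theta :&: L by rewrite inE UA.
have: B \in Utheta q theta :&: L by rewrite inE UB.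
by rewrite e !inE => /eqP eB /eqP eA; rewrite eA eB eqxx in AB.
Qed.

End ShiftPlane.

(** * Projective lines and transport of collinearity *)

Definition dot (F : finFieldType) (l A : PGcoord F) : F :=
  l.1.1 * A.1.1 + l.1.2 * A.1.2 + l.2 * A.2.

(** Cofactor expansion: each coordinate of [l] times the determinant is a combination of the three
    dot products. *)
Lemma vdet_dot0 (F : finFieldType) (l A B C : PGcoord F) : l != (0, 0, 0) ->
  dot l A = 0 -> dot l B = 0 -> dot l C = 0 -> vdet A B C = 0.
Proof.
case: l => [[l1 l2] l3] l0 dA dB dC.
have e m1 m2 m3 : m1 * dot (l1, l2, l3) A + m2 * dot (l1, l2, l3) B
                  + m3 * dot (l1, l2, l3) C = 0.
  by rewrite dA dB dC !mulr0 !addr0.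
have e1 : l1 * vdet A B C = 0.
  rewrite -(e (B.1.2 * C.2 - B.2 * C.1.2) (A.2 * C.1.2 - A.1.2 * C.2) (A.1.2 * B.2 - A.2 * B.1.2)).
  by rewrite /vdet /dot /=; ring.
have e2 : l2 * vdet A B C = 0.
  rewrite -(e (B.2 * C.1.1 - B.1.1 * C.2) (A.1.1 * C.2 - A.2 * C.1.1) (A.2 * B.1.1 - A.1.1 * B.2)).
  by rewrite /vdet /dot /=; ring.
have e3 : l3 * vdet A B C = 0.
  rewrite -(e (B.1.1 * C.1.2 - B.1.2 * C.1.1) (A.1.2 * C.1.1 - A.1.1 * C.1.2) (A.1.1 * B.1.2 - A.1.2 * B.1.1)).
  by rewrite /vdet /dot /=; ring.
apply: contraNeq l0 => v0.
have z0 m : m * vdet A B C = 0 -> m = 0.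
  by move/eqP; rewrite mulf_eq0 (negPf v0) orbF => /eqP.
by rewrite (z0 _ e1) (z0 _ e2) (z0 _ e3).
Qed.

(** If [dot l C] were nonzero, the four-point determinant identity would make [vdet A B D] vanish
    for all [D], forcing [A = B]. *)
Lemma dot_vdet0 (F : finFieldType) (l A B C : PGcoord F) :
  pg_normalized A -> pg_normalized B -> A != B ->
  dot l A = 0 -> dot l B = 0 -> vdet A B C = 0 -> dot l C = 0.
Proof.
move=> nA nB AB dA dB v0; apply/eqP; apply: contraNT AB => dC.
apply/eqP/pg_normalized_eq => // D; apply: (mulfI dC); rewrite mulr0.
have -> : dot l C * vdet A B D = vdet A B C * dot l D + dot l A * vdet C B D - dot l B * vdet C A D.
  by rewrite /vdet /dot; ring.
by rewrite dA dB v0 !mul0r !addr0 subrr.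
Qed.

Lemma in_pgLine (F : finFieldType) (l A : PGcoord F) :
  (A \in pgLine l) = pg_normalized A && (dot l A == 0).
Proof. by rewrite !inE. Qed.

Section Isomorphism.

Variables (F : finFieldType) (f : F -> F) (q : nat) (theta : F).
Hypothesis f_planar : planar f.
Hypothesis unital : is_unital q (piLines f) (Utheta q theta).
Let U := Utheta q theta.
Let H := hermitian_curve F q.
Variable phi : PiPoint F -> PGcoord F.
Hypothesis phi_inj : {in U &, injective phi}.
Hypothesis phi_im : phi @: U = H.
Hypothesis phi_blocks :
  [set (phi @: b : {set PGcoord F}) | b : {set PiPoint F} in blocks_of (piLines f) U q.+1]
  = blocks_of (pgLines F) H q.+1.

Lemma phi_hermitian A : A \in U -> phi A \in H.
Proof. by rewrite -phi_im; apply: imset_f. Qed.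

Lemma phi_normalized A : A \in U -> pg_normalized (phi A).
Proof. by move/phi_hermitian; rewrite !inE => /andP[]. Qed.

Lemma phi_block A B L : L \in piLines f -> A \in U -> B \in U -> A != B ->
  A \in L -> B \in L -> exists2 l, l != (0, 0, 0) & phi @: (U :&: L) = H :&: pgLine l.
Proof.
move=> LL UA UB AB LA LB; have cardL := secant_card unital LL UA UB AB LA LB.
have : phi @: (U :&: L) \in blocks_of (pgLines F) H q.+1.
  rewrite -phi_blocks; apply: imset_f; apply/imsetP; exists L => //.
  by rewrite inE LL.
case/imsetP=> M; rewrite inE => /andP[/imsetP[l + ->] _] ->.
by rewrite inE; exists l.
Qed.

(** The line joining [A] and [B] cuts out a block, whose image is cut out by a projective line. For
    the converse, that projective line contains [phi C], and injectivity brings [C] back to the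
    block. *)
Lemma phi_collinear A B C : A \in U -> B \in U -> C \in U -> A != B ->
  collinear f A B C <-> vdet (phi A) (phi B) (phi C) = 0.
Proof.
move=> UA UB UC AB; split.
  case=> L LL [LA LB LC]; have [l l0 e] := phi_block LL UA UB AB LA LB.
  have d0 D : D \in U -> D \in L -> dot l (phi D) = 0.
    move=> UD LD; have : phi D \in phi @: (U :&: L) by rewrite imset_f // inE UD.
    by rewrite e inE in_pgLine => /and3P[_ _ /eqP].
  by apply: (vdet_dot0 l0); apply: d0.
move=> v0; have [L LL /andP[LA LB]] := join_Utheta f_planar UA UB.
exists L => //; split=> //; have [l l0 e] := phi_block LL UA UB AB LA LB.
have d0 D : D \in U -> D \in L -> dot l (phi D) = 0.
  move=> UD LD; have : phi D \in phi @: (U :&: L) by rewrite imset_f // inE UD.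
  by rewrite e inE in_pgLine => /and3P[_ _ /eqP].
have : phi C \in phi @: (U :&: L).
  rewrite e inE phi_hermitian // in_pgLine phi_normalized //=; apply/eqP.
  apply: dot_vdet0 v0; rewrite ?phi_normalized ?d0 //.
  by rewrite (inj_in_eq phi_inj).
by case/imsetP=> D; rewrite inE => /andP[UD LD] /phi_inj -> .
Qed.

End Isomorphism.

(** * Evenness of [f] and conclusion *)

(** All exponents are even: [p ^ i + p ^ j] since [p] is odd, and [(3 ^ k + 1) / 2] since
    coprimality makes [k] odd, so that 4 divides [3 ^ k + 1]. *)
Lemma DO_or_CM_even (p q : nat) (F : finFieldType) (f : F -> F) :
  odd p -> is_DO p f \/ is_CM p q f -> forall x, f (- x) = f x.
Proof.
have evenX n (x : F) : ~~ odd n -> (- x) ^+ n = x ^+ n.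
  by move=> n_even; rewrite exprNn -signr_odd (negPf n_even) expr0 mul1r.
move=> odd_p [[n [a fE]]|[_ [n [k [_ [cop fE]]]]]] x.
  rewrite !fE; apply: eq_bigr => i _; apply: eq_bigr => j _.
  by rewrite evenX // oddD !oddX odd_p !orbT.
rewrite !fE evenX //.
have k_odd : odd k.
  apply: contraTT cop => k_even.
  by rewrite /coprime; apply/eqP => /(congr1 (dvdn 2)); rewrite dvdn_gcd dvdn_mulr // dvdn2 k_even.
have /dvdnP[m ->] : (4 %| 3 ^ k + 1)%N.
  rewrite -(odd_double_half k) k_odd add1n expnS -mul2n expnM /dvdn -modnDml -modnMmr.
  by rewrite -modnXm exp1n.
by rewrite (_ : 4 = 2 * 2)%N // mulnA mulnK // oddM andbF.
Qed.

Theorem theorem4p7 (p q : nat) (F : finFieldType) (f : F -> F) (theta : F) :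
  prime p -> odd p -> (exists e : nat, (0 < e)%N /\ q = (p ^ e)%N) ->
  #|F| = (q ^ 2)%N ->
  planar f ->
  (is_DO p f \/ is_CM p q f) ->
  theta != 0 ->
  is_unital q (piLines f) (Utheta q theta) ->
  ~ design_iso (Utheta q theta) (blocks_of (piLines f) (Utheta q theta) q.+1)
               (hermitian_curve F q) (blocks_of (pgLines F) (hermitian_curve F q) q.+1).
Proof.
move=> p_prime p_odd [e [e0 qE]] cardF f_planar fDOCM theta0 unital [phi [phi_inj [phi_im phi_blocks]]].
have f_even := DO_or_CM_even p_odd fDOCM.
have p_char : p \in [pchar F].
  by apply: (@card_finPcharP _ _ (e * 2)) => //; rewrite cardF qE expnM.
have q_odd : odd q by rewrite qE oddX p_odd orbT.
have q1 : (1 < q)%N by rewrite qE -(exp1n e) ltn_exp2r // prime_gt1.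
have [c cE] : exists c : {rmorphism F -> F}, forall x, c x = x ^+ q.
  by apply: power_rmorphism; rewrite (eq_pnat _ (pcharf_eq p_char)) qE pnatX pnat_id.
have cK : involutive c by move=> x; rewrite !cE -exprM mulnn -cardF expf_card.
have two_neq0 : (2 : F) != 0.
  rewrite -(dvdn_pcharf p_char) dvdn_prime2 //.
  by apply: contraTneq p_odd => ->.
have fixE : [set x | c x == x] = subFq F q by apply/setP => x; rewrite !inE cE.
have card_fix : #|[set x | c x == x]| = q.
  have := card_Uaff unital; rewrite card_Uaff_fix // cardF (expnSr q 2) fixE.
  by move/eqP; rewrite eqn_mul2l expn_eq0 andbT => /orP[|/eqP//]; rewrite eqn0Ngt (ltnW q1).
have [g cg] : exists g, c g != g.
  apply/existsP; apply: contraT; rewrite negb_exists => /forallP all_fix.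
  have : #|[set x | c x == x]| = #|F|.
    by apply: eq_card => x; rewrite !inE; apply/negbNE.
  by rewrite card_fix cardF => qq; have := ltn_Pmull q1 (ltnW q1); rewrite mulnn -qq ltnn.
have odd_fix : odd #|[set x | c x == x]| by rewrite card_fix.
pose U := Utheta q theta.
have form_iso A : A \in U -> form c (phi A) (phi A) = 0.
  move/(phi_hermitian phi_im); rewrite !inE => /andP[_ /eqP e0'].
  by rewrite /form !cE -!exprS.
have form_neq0 A B : A \in U -> B \in U -> A != B -> form c (phi A) (phi B) != 0.
  move=> UA UB AB; apply: isotropic_form_neq0 => //.
  - exact: phi_normalized phi_im _ _.
  - exact: phi_normalized phi_im _ _.
  - by rewrite (inj_in_eq phi_inj).
  - exact: form_iso.
  - exact: form_iso.
have zeroU a : inl (a, 0) \in U.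
  by rewrite in_Utheta // mul0r inE expr0n -[q == 0%N]negbK -lt0n (ltnW q1).
have UI : inr None \in U := infty_Utheta q theta.
(* [P] must be the image of infinity for blocks through infinity to become vertical; [Q] is a
   convenient second point. *)
pose P := phi (inr None); pose Q := phi (inl (0, 0)).
have fP : form c P P = 0 := form_iso _ UI.
have fQ : form c Q Q = 0 := form_iso _ (zeroU 0).
have fPQ : form c P Q != 0 by apply: form_neq0.
pose G z := coords c P Q (phi (inl z)).
pose V := Uaff q theta.
have VU z : z \in V -> inl z \in U by rewrite in_Uaff.
have fV z : z \in V -> form c (phi (inl z)) P != 0.
  by move=> Vz; apply: form_neq0; rewrite ?VU.
have G_inj : {in V &, injective G}.
  move=> z w Vz Vw /coords_inj e'.
  have /phi_inj : phi (inl z) = phi (inl w).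
    by apply: e'; rewrite ?fV ?(phi_normalized phi_im) ?VU.
  by rewrite !VU // => /(_ isT isT) [].
have inl_eq z w : (inl z == inl w :> PiPoint F) = (z == w).
  by apply/eqP/eqP => [[]|->].
apply: (@no_reflection_coordinates F c cK two_neq0 g cg odd_fix V G
          (fun z w v => collinear f (inl z) (inl w) (inl v))).
- by move=> a; rewrite in_Uaff zeroU.
- by move=> a x y; rewrite !in_Uaff !in_Utheta.
- exact: G_inj.
(* The inclusion is [aherm_coords]; equality follows from injectivity of [G] and the bound on the
   curve. *)
- apply/eqP; rewrite eqEcard; apply/andP; split.
    apply/subsetP => _ /imsetP[z Vz ->]; rewrite inE.
    exact: (aherm_coords cK fP fQ (fV z Vz) (form_iso _ (VU _ Vz))).
  rewrite (card_in_imset G_inj) card_Uaff_fix // -fixE.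
  exact: card_aherm_le cg.
- move=> z w Vz Vw; have [->|zw] := eqVneq z w; first by rewrite !eqxx.
  rewrite coords_col ?fV //; apply/eqP/eqP => [v0|zw1].
    apply/(collinear_infty f); apply/(phi_collinear f_planar unital phi_inj phi_im phi_blocks) => //.
    + exact: VU.
    + exact: VU.
  apply/(phi_collinear f_planar unital phi_inj phi_im phi_blocks); rewrite ?VU //.
  exact/collinear_infty.
- move=> z w v Vz Vw Vv zw.
  rewrite (rwP eqP) coords_det ?fV // -(rwP eqP).
  by apply: (phi_collinear f_planar unital phi_inj phi_im phi_blocks); rewrite ?VU ?inl_eq.
- exact: collinear_reflection.
Qed.
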